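(* Let $\{(\phi^n,u^n)\}_{n=0}^{N}$ and $\{\eta^{n-\frac12}\}_{n=1}^{N}$ satisfy the CN-IEQ time-stepping scheme: for $1\leq n\leq N$, $$(\partial_{\tau}^{\alpha}\phi)^{n-\frac12}=-\lambda\left(-\varepsilon^{2}\Delta\phi^{n-\frac12}+\beta\phi^{n-\frac12}+u^{n-\frac12}\hat{\phi}^{n-\frac12}-\eta^{n-\frac12}\right),$$ $$\eta^{n-\frac12}=\frac{1}{|\Omega|}\int_{\Omega}\left(-\varepsilon^{2}\Delta\phi^{n-\frac12}+\beta\phi^{n-\frac12}+u^{n-\frac12}\hat{\phi}^{n-\frac12}\right)\mathrm{d}\mathbf{x},$$ $$\partial_{\tau}u^{n-\frac12}=2\hat{\phi}^{n-\frac12}\,\partial_{\tau}\phi^{n-\frac12}.$$ Then the scheme conserves the volume: $$\int_{\Omega}\phi^{n}\,\mathrm{d}\mathbf{x}=\int_{\Omega}\phi^{n-1}\,\mathrm{d}\mathbf{x}\quad\text{for } 1\leq n\leq N.$$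
   Context: Parameters: $0<\alpha<1$, $\lambda>0$ (mobility), $\varepsilon>0$ (interface width), $\beta$ a real regularization parameter. $\Omega\subset\mathbb{R}^d$ is a bounded rectangular domain with periodic boundary conditions, and $|\Omega|$ is its measure. The scheme is discrete in time only; the functions $\phi^n,u^n:\Omega\to\mathbb{R}$ are $\Omega$-periodic and sufficiently smooth in space for all expressions to make sense, and $\eta^{n-\frac12}\in\mathbb{R}$ is constant in space. Time mesh: arbitrary nonuniform levels $0=t_0<t_1<\cdots<t_N=T$, steps $\tau_k:=t_k-t_{k-1}$, local step ratios $\rho_k:=\tau_k/\tau_{k+1}$. For a sequence $\{v^k\}$: $\triangledown_\tau v^k:=v^k-v^{k-1}$, $\partial_\tau v^{k-\frac12}:=\triangledown_\tau v^k/\tau_k$, $v^{k-\frac12}:=(v^k+v^{k-1})/2$ for $k\geq1$. L1$^+$ formula (approximating the Caputo derivative of order $\alpha$): $$(\partial_\tau^\alpha v)^{n-\frac12}:=\sum_{k=1}^n a_{n-k}^{(n)}\triangledown_\tau v^k,\qquad a_{n-k}^{(n)}:=\frac{1}{\tau_n\tau_k}\int_{t_{n-1}}^{t_n}\int_{t_{k-1}}^{\min\{t,t_k\}}\omega_{1-\alpha}(t-s)\,\mathrm{d}s\,\mathrm{d}t\quad(1\leq k\leq n),$$ where $\omega_{\mu}(t):=t^{\mu-1}/\Gamma(\mu)$. Extrapolation: $\hat\phi^{n-\frac12}:=\phi^{n-1}+\triangledown_\tau\phi^{n-1}/(2\rho_{n-1})$ for $n\geq2$; for $n=1$, $\hat\phi^{\frac12}$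 is a prescribed smooth $\Omega$-periodic function (for instance $\phi^0$). Initial data: $\phi^0=\phi_0$ is given and $u^0=\phi_0^2-1-\beta$. *)

(* Defs.v *)
From HB Require Import structures.
From mathcomp Require Import all_boot all_order all_algebra.
From mathcomp Require Import all_classical all_reals all_analysis.

Set Implicit Arguments.
Unset Strict Implicit.
Unset Printing Implicit Defensive.

Import Order.TTheory GRing.Theory Num.Theory.
Import numFieldNormedType.Exports.

Local Open Scope classical_set_scope.
Local Open Scope ring_scope.

(* The n-fold product of a sigma-finite measure, on n-tuples. *)
Section tuple_measure.
Context d (T : measurableType d) (R : realType).
Local Open Scope ereal_scope.

Section cons_measure.
Variables (n : nat) (m1 : {sigma_finite_measure set T -> \bar R}).
Variable m2 : {sigma_finite_measure set (n.-tuple T) -> \bar R}.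

Let cons_pair (x : T * n.-tuple T) : n.+1.-tuple T := [tuple of x.1 :: x.2].

Let uncons (x : n.+1.-tuple T) : T * n.-tuple T :=
  (thead x, [tuple of behead x]).

Let measurable_cons_pair : measurable_fun setT cons_pair.
Proof. exact: (measurable_cons measurable_fst measurable_snd). Qed.

Let measurable_uncons : measurable_fun setT uncons.
Proof.
apply/measurable_fun_pairP; split.
- exact: measurable_tnth.
- exact: measurable_behead.
Qed.

Let cons_pairK : cancel cons_pair uncons.
Proof. by case=> a b; rewrite /uncons theadE; congr pair; apply/val_inj. Qed.

Definition cons_measure : set (n.+1.-tuple T) -> \bar R :=
  pushforward (m1 \x m2) (fun x => [tuple of x.1 :: x.2]).

Let cons_measure0 : cons_measure set0 = 0.
Proof. by rewrite /cons_measure /pushforward preimage_set0 measure0. Qed.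

Let cons_measure_ge0 A : 0 <= cons_measure A.
Proof. exact: measure_ge0. Qed.

Let cons_measure_sigma_additive : semi_sigma_additive cons_measure.
Proof.
have mc A : measurable A -> measurable (cons_pair @^-1` A).
  by move=> mA; rewrite -[_ @^-1` _]setTI; exact: measurable_cons_pair.
move=> F mF tF mUF; rewrite /cons_measure /pushforward preimage_bigcup.
apply: measure_semi_sigma_additive.
- by move=> i; exact: mc.
- apply/trivIsetP => /= i j _ _ ij; rewrite -preimage_setI.
  by move/trivIsetP : tF => /(_ _ _ _ _ ij) ->//; rewrite preimage_set0.
- by rewrite -preimage_bigcup; exact: mc.
Qed.

HB.instance Definition _ := isMeasure.Build _ _ _ cons_measure
  cons_measure0 cons_measure_ge0 cons_measure_sigma_additive.

Let cons_measure_sigma_finite : sigma_finite setT cons_measure.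
Proof.
have /sigma_finiteP[F [TF ndF Foo]] := sigma_finiteT m1.
have /sigma_finiteP[G [TG ndG Goo]] := sigma_finiteT m2.
exists (fun i => uncons @^-1` (F i `*` G i)).
  apply/esym; rewrite -subTset => x _.
  have [i _ Fi] : (\bigcup_i F i) (thead x) by rewrite -TF.
  have [j _ Gj] : (\bigcup_i G i) [tuple of behead x] by rewrite -TG.
  exists (maxn i j) => //; split => /=.
  - by move: Fi; exact/subsetPset/ndF/leq_maxl.
  - by move: Gj; exact/subsetPset/ndG/leq_maxr.
move=> i; have [mF Fi] := Foo i; have [mG Gi] := Goo i; split.
  by rewrite -[_ @^-1` _]setTI; apply: measurable_uncons => //; exact: measurableX.
rewrite /cons_measure /pushforward (_ : _ @^-1` _ = F i `*` G i).
  by rewrite product_measure1E// lte_mul_pinfty// ge0_fin_numE.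
by apply/funext => x; rewrite -[LHS]/((_ `*` _) (uncons (cons_pair x))) cons_pairK.
Qed.

HB.instance Definition _ := @Measure_isSigmaFinite.Build _ _ _ cons_measure
  cons_measure_sigma_finite.

End cons_measure.

Variable m : {sigma_finite_measure set T -> \bar R}.

Fixpoint tuple_measure (n : nat) :
    {sigma_finite_measure set (n.-tuple T) -> \bar R} :=
  if n is k.+1 then cons_measure m (tuple_measure k) else dirac [tuple].

Lemma tuple_measure_box n (A : 'I_n -> set T) : (forall i, measurable (A i)) ->
  tuple_measure n [set x | forall i, A i (tnth x i)] = \prod_(i < n) m (A i).
Proof.
elim: n A => [|n IHn] A mA.
  rewrite big_ord0 /= diracE mem_set//= => -[]//.
rewrite big_ord_recl -IHn//.
have mA' : measurable [set x : n.-tuple T | forall i, A (lift ord0 i) (tnth x i)].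
  rewrite (_ : [set x | _] =
      \bigcap_(i in [set: 'I_n]) ((@tnth n T)^~ i @^-1` A (lift ord0 i))).
    apply: fin_bigcap_measurable => // i _; rewrite -[_ @^-1` _]setTI.
    exact: measurable_tnth.
  by apply/seteqP; split => x /= Ax i => [_|]; exact: Ax.
rewrite -product_measure1E// /= /cons_measure /pushforward.
congr (product_measure1 _ _); apply/seteqP; split => -[a x] /=.
  move=> Ax; split => [|i]; first by have := Ax ord0; rewrite tnth0.
  by have := Ax (lift ord0 i); rewrite tnthS.
move=> [Aa Ax] i; case: (unliftP ord0 i) => [j|] ->; rewrite ?tnth0 ?tnthS//.
Qed.

End tuple_measure.

Section space.
Context {R : realType} {d : nat}.
Implicit Types (f : 'rV[R]_d -> R) (x : 'rV[R]_d).

(* Row vectors carry the topology but no sigma-algebra in the library; tuples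
   carry the sigma-algebra but no topology. *)
Definition row_of_tuple (s : d.-tuple (measurableTypeR R)) : 'rV[R]_d :=
  \row_i (tnth s i : R).

Definition lebesgue_tuple :=
  tuple_measure (lebesgue_measure : set (measurableTypeR R) -> \bar R) d.

Definition vol (D : set 'rV[R]_d) : R :=
  fine (lebesgue_tuple (row_of_tuple @^-1` D)).

Definition space_integral (D : set 'rV[R]_d) f : R :=
  \int[lebesgue_tuple]_(s in row_of_tuple @^-1` D) f (row_of_tuple s).

Definition box (a b : 'rV[R]_d) : set 'rV[R]_d :=
  [set x | forall i, a 0 i < x 0 i < b 0 i].

Lemma vol_box (a b : 'rV[R]_d) : (forall i, a 0 i < b 0 i) ->
  vol (box a b) = \prod_i (b 0 i - a 0 i).
Proof.
move=> ab; rewrite /vol /lebesgue_tuple.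
pose A i : set (measurableTypeR R) := `]a 0 i, b 0 i[%classic.
rewrite (_ : _ @^-1` _ = [set s | forall i, A i (tnth s i)]); last first.
  by apply/seteqP; split => s /= H i; have := H i; rewrite /A /= !mxE in_itv.
rewrite tuple_measure_box => [|i]; last exact: measurable_itv.
rewrite (eq_bigr (fun i => (b 0 i - a 0 i)%:E)) ?prodEFin// => i _.
by rewrite [LHS]lebesgue_measure_itv /= lte_fin ab.
Qed.

Definition basis_vec (i : 'I_d) : 'rV[R]_d := delta_mx 0 i.

(* Functions on the torus are functions on R^d with period b i - a i in the
   i-th coordinate, (a, b) being the opposite corners of the domain. *)
Definition box_periodic (a b : 'rV[R]_d) f :=
  forall i, periodic f ((b 0 i - a 0 i) *: basis_vec i).

Definition C2 f :=
  [/\ continuous f,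
      forall i, (forall x, derivable f x (basis_vec i)) /\
                continuous ('D_(basis_vec i) f) &
      forall i j, (forall x, derivable ('D_(basis_vec i) f) x (basis_vec j)) /\
                  continuous ('D_(basis_vec j) ('D_(basis_vec i) f))].

Definition laplacian f x : R :=
  \sum_i 'D_(basis_vec i) ('D_(basis_vec i) f) x.

End space.

Section time.
Context {R : realType}.
Implicit Types (t v : nat -> R) (alpha : R) (n k : nat).

Definition time_mesh (N : nat) (T : R) t :=
  [/\ (0 < N)%N, t 0%N = 0, forall k, (k < N)%N -> t k < t k.+1 & t N = T].

(* Meaningful for k >= 1 only; [dtau t v k] and [midpoint v k] are the values
   attached to the half level k - 1/2. *)
Definition tau t k : R := t k - t k.-1.
Definition step_ratio t k : R := tau t k / tau t k.+1.
Definition nabla v k : R := v k - v k.-1.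
Definition dtau t v k : R := nabla v k / tau t k.
Definition midpoint v k : R := (v k + v k.-1) / 2.

Definition Gamma (z : R) : R :=
  \int[lebesgue_measure]_(x in `]0, +oo[%classic) (x `^ (z - 1) * expR (- x)).

Definition omega (mu x : R) : R := x `^ (mu - 1) / Gamma mu.

(* [L1p_coef alpha t n k] is the coefficient a_{n-k}^{(n)}. *)
Definition L1p_coef alpha t n k : R :=
  (tau t n * tau t k)^-1 *
  \int[lebesgue_measure]_(x in `[t n.-1, t n]%classic)
    \int[lebesgue_measure]_(s in `[t k.-1, Num.min x (t k)]%classic)
      omega (1 - alpha) (x - s).

Definition L1p alpha t v n : R :=
  \sum_(1 <= k < n.+1) L1p_coef alpha t n k * nabla v k.

End time.

Section scheme.
Context {R : realType} {d : nat}.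
Implicit Types (phi u : nat -> 'rV[R]_d -> R) (phih : 'rV[R]_d -> R).

(* [extrap t phih phi n] is phihat^{n-1/2}, with phih = phihat^{1/2}. *)
Definition extrap (t : nat -> R) phih phi n (x : 'rV[R]_d) : R :=
  if (n <= 1)%N then phih x
  else phi n.-1 x + nabla (phi ^~ x) n.-1 / (2 * step_ratio t n.-1).

(* [potential _ _ _ _ _ _ n] is
   -eps^2 Lap phi^{n-1/2} + beta phi^{n-1/2} + u^{n-1/2} phihat^{n-1/2}. *)
Definition potential (eps beta : R) (t : nat -> R) phih phi u n
    (x : 'rV[R]_d) : R :=
  - eps ^+ 2 * laplacian (fun y => midpoint (phi ^~ y) n) x
  + beta * midpoint (phi ^~ x) n
  + midpoint (u ^~ x) n * extrap t phih phi n x.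

(* [eta n] is eta^{n-1/2}. *)
Definition CN_IEQ (alpha lambda eps beta : R) (D : set 'rV[R]_d)
    (N : nat) (t : nat -> R) phih phi u (eta : nat -> R) :=
  forall n, (1 <= n <= N)%N ->
  [/\ forall x, D x ->
        L1p alpha t (phi ^~ x) n =
        - lambda * (potential eps beta t phih phi u n x - eta n),
      eta n =
        (vol D)^-1 * space_integral D (potential eps beta t phih phi u n) &
      forall x, D x ->
        dtau t (u ^~ x) n =
        2 * extrap t phih phi n x * dtau t (phi ^~ x) n].

End scheme.

(* Main.v *)
From HB Require Import structures.
Require Import Defs.
From mathcomp Require Import all_boot all_order all_algebra.
From mathcomp Require Import all_classical all_reals all_analysis.
From mathcomp Require Import measurable_realfun ring lra.

Import Order.TTheory GRing.Theory Num.Theory.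
Import numFieldNormedType.Exports.

Local Open Scope classical_set_scope.
Local Open Scope ring_scope.

(** Integrate the phase equation over the domain. As [eta n] is the mean value
    of the potential, the right-hand side [- lambda * (potential - eta n)] has
    integral zero ([space_integral_sub_mean]). The L1+ operator acts on time
    only, hence commutes with the space integral ([space_integral_L1p]): the
    sequence of volumes [M k], the integral of [phi k] over the domain,
    satisfies [L1p alpha t M n = 0] for every [n] from 1 to [N], that is
      a_0^(n) (M n - M (n-1))
        + sum over 1 <= k < n of a_(n-k)^(n) (M k - M (k-1)) = 0.
    By strong induction on [n] the sum vanishes, and since the diagonal
    coefficient a_0^(n) is positive ([L1p_coef_diag_gt0]) the last difference
    vanishes too ([L1p_eq0_stationary]).

    Two points need analysis. First, a_0^(n) is an iterated integral of the
    weakly singular kernel (x - s)^(- alpha) / Gamma (1 - alpha); since the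
    real-valued integral of a function with infinite integral is 0, positivity
    requires both that the integrands be positive on a set of positive measure
    ([Rintegral_gt0]) and that the integrals be finite, which comes down to
    the integrability of r^p at 0 for p > -1 ([integrable_powR]). Second, the
    interchange of finite sums and space integrals requires that continuous
    functions be integrable on the box ([integrable_continuous_box]): they are
    bounded there by compactness of the closed box, and measurable for the
    product sigma-algebra because an open set is a countable union of balls
    with rational centres and radii ([measurable_row_preimage]). *)

(** * Positivity of real-valued integrals *)

(** A nonnegative function with zero integral vanishes almost everywhere, which
    contradicts its positivity on [A]. *)
Lemma Rintegral_gt0 d (X : measurableType d) (R : realType)
    (mu : {measure set X -> \bar R}) (D A : set X) (f : X -> R) :
  measurable D -> measurable A -> A `<=` D -> (0 < mu A)%E ->
  mu.-integrable D (EFin \o f) ->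
  (forall x, D x -> 0 <= f x) -> (forall x, A x -> 0 < f x) ->
  0 < \int[mu]_(x in D) f x.
Proof.
move=> mD mA AD muA fi f0 fA.
rewrite lt_neqAle Rintegral_ge0// andbT eq_sym; apply/negP => /eqP int0.
have int0E : (\int[mu]_(x in D) `|(EFin \o f) x| = 0)%E.
  rewrite -[RHS]/((0 : R)%:E) -int0 [RHS]fineK; last exact: integrable_fin_num.
  by apply: eq_integral => x /set_mem Dx; rewrite /= ger0_norm// f0.
have /ae_eq_integral_abs [//||N [mN muN fN]] := int0E.
  exact: measurable_int fi.
have AN : A `<=` N.
  move=> x Ax; apply: fN => /= /(_ (AD _ Ax)) [fx0].
  by have := fA _ Ax; rewrite fx0 ltxx.
have : (mu A <= mu N)%E by apply: le_measure; rewrite ?inE.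
by rewrite muN leNgt muA.
Qed.

(** * The weakly singular kernel and the Gamma function *)

Section kernel.
Context {R : realType}.
Notation mu := (@lebesgue_measure R).
Implicit Types p h x z alpha : R.

Lemma measurable_powR_EFin p (D : set R) :
  measurable_fun D (EFin \o (fun r : R => r `^ p)).
Proof.
by apply/measurable_EFinP; apply: measurable_funTS; exact: measurable_powR.
Qed.

(** The bound does not depend on the cut-off [c]: it is the value at [h] of the
    primitive of [r `^ p] that vanishes at 0. *)
Lemma integral_powR_away0 p c h : -1 < p -> 0 < c -> c < h ->
  (\int[mu]_(r in `[c, h]) (r `^ p)%:E <= (h `^ (p + 1) / (p + 1))%:E)%E.
Proof.
move=> p1 c0 ch; have q0 : 0 < p + 1 by lra.
pose F : R -> R := (p + 1)^-1 \*: (fun r : R => r `^ (p + 1)).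
have dF x : 0 < x -> is_derive x 1 F (x `^ p).
  move=> x0; have dpow := @is_derive1_powR R (p + 1) x x0.
  apply: is_derive_eq.
  by rewrite addrK /GRing.scale/= mulrA mulVf ?mul1r ?gt_eqF.
have cF x : 0 < x -> {for x, continuous F}.
  move=> x0; apply: differentiable_continuous; apply/derivable1_diffP.
  by have [] := dF x x0.
rewrite (@continuous_FTC2 _ _ F) //.
- rewrite [_ / _]mulrC.
  by rewrite -EFinB lee_fin lerBlDr lerDl mulr_ge0 ?powR_ge0 ?invr_ge0 ?ltW.
- apply: continuous_in_subspaceT => x /set_mem; rewrite /= in_itv/= => /andP[cx _].
  apply: differentiable_continuous; apply/derivable1_diffP.
  by apply: derivable_powR; rewrite in_itv/= andbT (lt_le_trans c0).
- split.
  + move=> x; rewrite in_itv/= => /andP[cx _].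
    by have [] := dF x (lt_trans c0 cx).
  + by apply: cvg_at_right_filter; exact: cF.
  + by apply: cvg_at_left_filter; apply: cF; exact: lt_trans ch.
- move=> x; rewrite in_itv/= => /andP[cx _].
  by rewrite derive1E; have [_ ->] := dF x (lt_trans c0 cx).
Qed.

(** The singularity at 0 is avoided by exhausting ]0, h] with the intervals
    [h / (n + 2), h]; the integrals over them increase and are uniformly
    bounded by [integral_powR_away0]. *)
Lemma integrable_powR p h : -1 < p ->
  mu.-integrable `[0, h] (fun r : R => (r `^ p)%:E).
Proof.
move=> p1; apply/integrableP; split; first exact: measurable_powR_EFin.
under eq_integral do rewrite /= ger0_norm ?powR_ge0//.
rewrite -integral_itv_obnd_cbnd; last exact: measurable_powR_EFin.
have [h0|h0] := leP h 0; first by rewrite set_itv_ge ?integral_set0// -leNgt bnd_simp.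
pose F (n : nat) : set R := `[h / n.+2%:R, h]%classic.
have FE : `]0, h]%classic = \bigcup_n F n.
  apply/seteqP; split => x /=; last first.
    move=> [n _]; rewrite /F/= !in_itv/= => /andP[hx ->]; rewrite andbT.
    by rewrite (lt_le_trans _ hx)// divr_gt0.
  rewrite in_itv/= => /andP[x0 xh].
  exists (Num.trunc (h / x)) => //; rewrite /F/= in_itv/= xh andbT.
  rewrite ler_pdivrMr// mulrC -ler_pdivrMr//.
  apply: ltW; apply: (lt_le_trans (truncnS_gt _)).
  by rewrite ler_nat.
rewrite FE; have nF : nondecreasing_seq F.
  apply/nondecreasing_seqP => n; apply/subsetPset => x.
  rewrite /F/= !in_itv/= => /andP[hx ->]; rewrite andbT (le_trans _ hx)//.
  by rewrite ler_pM2l// lef_pV2 ?posrE// ler_nat.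
have cF : (\int[mu]_(r in F n) (r `^ p)%:E @[n --> \oo] -->
    \int[mu]_(r in \bigcup_n F n) (r `^ p)%:E)%E.
  apply: ge0_nondecreasing_set_cvg_integral => //.
  - by move=> n; exact: measurable_itv.
  - by move=> n; exact: measurable_powR_EFin.
  - by move=> n x _; rewrite lee_fin powR_ge0.
rewrite -(cvg_lim _ cF)//.
apply: (@le_lt_trans _ _ (h `^ (p + 1) / (p + 1))%:E); last exact: ltry.
apply: lime_le; first by apply/cvg_ex; exists (\int[mu]_(r in \bigcup_n F n) (r `^ p)%:E)%E.
apply: nearW => n; apply: integral_powR_away0 => //.
  by rewrite divr_gt0.
by rewrite ltr_pdivrMr// ltr_pMr// ltr1n.
Qed.

(** For such [z] the integrand is dominated by [x `^ (z - 1)] on ]0, 1] and by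
    [expR (- x)] beyond 1, so that the integral is finite. *)
Lemma Gamma_gt0 z : 0 < z <= 1 -> 0 < Gamma z.
Proof.
move=> /andP[z0 z1].
have mf (D : set R) : measurable_fun D (EFin \o (fun x : R => x `^ (z - 1) * expR (- x))).
  apply/measurable_EFinP; apply: measurable_funTS; apply: measurable_funM.
    exact: measurable_powR.
  by apply: measurableT_comp => //; exact: measurable_expR.
have split01 : `]0, +oo[%classic = `]0, 1] `|` `]1, +oo[ :> set R.
  by rewrite -itv_bndbnd_setU// bnd_simp.
have near0 : mu.-integrable `]0, 1] (fun x : R => (x `^ (z - 1) * expR (- x))%:E).
  apply: (@le_integrable _ _ _ mu _ _ _ (fun x : R => (x `^ (z - 1))%:E)) => //.
  - exact: mf.
  - move=> x /=; rewrite in_itv/= => /andP[x0 _].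
    rewrite lee_fin !ger0_norm ?mulr_ge0 ?powR_ge0 ?expR_ge0//.
    by rewrite ler_piMr ?powR_ge0// expR_le1 oppr_le0 ltW.
  apply: integrableS (integrable_powR (z - 1) 1 _) => //.
    by apply: subset_itv_oc_cc.
  lra.
have atoo : mu.-integrable `]1, +oo[ (fun x : R => (x `^ (z - 1) * expR (- x))%:E).
  apply: (@le_integrable _ _ _ mu _ _ _ (EFin \o exponential_pdf 1)) => //.
  - exact: mf.
  - move=> x /=; rewrite in_itv/= andbT => x1.
    rewrite exponential_pdfE; last by rewrite ltW// (lt_trans _ x1).
    rewrite mul1r mulN1r lee_fin !ger0_norm ?mulr_ge0 ?powR_ge0 ?expR_ge0//.
    by rewrite ler_piMl ?expR_ge0// -[leRHS](powRr0 x) ler_powR ?subr_le0// ltW.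
  - by apply: integrableS (integrable_exponential_pdf ltr01) => //.
rewrite /Gamma; apply: (@Rintegral_gt0 _ (measurableTypeR R) R lebesgue_measure _ `]0, 1]%classic) => //=.
- by rewrite split01; exact: subsetUl.
- by rewrite lebesgue_measure_itv/= lte_fin ltr01 sube0 lte_fin.
- rewrite split01; apply/integrableP; split; first exact: mf.
  rewrite ge0_integral_setU//=.
  + by apply: lte_add_pinfty; [case/integrableP: near0|case/integrableP: atoo].
  + apply/measurable_EFinP; apply: measurableT_comp => //.
    by apply/measurable_EFinP; exact: mf.
  + apply/disj_setPS => x /= []; rewrite !in_itv/= andbT => /andP[_ x1].
    by rewrite ltNge x1.
- by move=> x _; rewrite mulr_ge0 ?powR_ge0 ?expR_ge0.
- move=> x; rewrite in_itv/= => /andP[x0 _].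
  by rewrite mulr_gt0 ?expR_gt0// powR_gt0.
Qed.

Lemma measurable_reflect x : measurable_fun [set: measurableTypeR R]
  ((fun s => x - s) : _ -> measurableTypeR R).
Proof. by apply: measurable_funB => //; exact: measurable_cst. Qed.

(** A measure on the line is determined by its values on half-open intervals,
    and reflection maps these to intervals of the same length. *)
Lemma lebesgue_measure_reflect x (A : set R) : measurable A ->
  pushforward mu ((fun s => x - s) : _ -> measurableTypeR R) A = mu A.
Proof.
pose mixin := isMeasurableFun.Build _ _ _ _ _ (measurable_reflect x).
pose refl : {mfun measurableTypeR R >-> measurableTypeR R} :=
  HB.pack ((fun s => x - s) : _ -> measurableTypeR R) mixin.
move=> mA; apply/esym.
apply: (@lebesgue_measure_unique R (pushforward mu refl)) => //= _ [[a b]] _ <-.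
rewrite /pushforward/=.
rewrite (_ : _ @^-1` _ = `[x - b, x - a[%classic); last first.
  apply/seteqP; split => s /=; rewrite !in_itv/=; lra.
rewrite !lebesgue_measure_itv/= !lte_fin ltrD2l ltrN2.
by case: ifPn => // _; rewrite -!EFinB; congr EFin; ring.
Qed.

(** Turns the convolution integral of the kernel into an integral over [0, h]
    with [h = x - a], whose dependence on [x] is monotone. *)
Lemma ge0_integral_reflect x a (f : R -> \bar R) :
  measurable_fun setT f -> (forall r, (0 <= f r)%E) ->
  (\int[mu]_(s in `[a, x]) f (x - s)%R = \int[mu]_(r in `[0%R, (x - a)%R]) f r)%E.
Proof.
move=> mf f0.
have -> : `[a, x]%classic =
    ((fun s => x - s) : _ -> measurableTypeR R) @^-1` `[0, x - a].
  apply/seteqP; split => s /=; rewrite !in_itv/=; lra.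
rewrite -ge0_integral_pushforward//=; last 2 first.
- exact: measurable_reflect.
- exact: measurable_funS mf.
apply: eq_measure_integral => [|mr A mA _]; [exact: measurable_reflect|].
exact: lebesgue_measure_reflect.
Qed.

Lemma nondecreasing_powR_integral p : -1 < p ->
  nondecreasing_fun (fun h => \int[mu]_(r in `[0, h]) (r `^ p)).
Proof.
move=> p1 h h' hh'; apply: fine_le.
- exact: integrable_fin_num (integrable_powR _ _ p1).
- exact: integrable_fin_num (integrable_powR _ _ p1).
apply: ge0_subset_integral => //.
- exact: measurable_powR_EFin.
- by move=> r _; rewrite lee_fin powR_ge0.
- by apply: subset_itvl; rewrite bnd_simp.
Qed.

Lemma powR_integral_gt0 p h : -1 < p -> 0 < h ->
  0 < \int[mu]_(r in `[0, h]) (r `^ p).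
Proof.
move=> p1 h0.
apply: (@Rintegral_gt0 _ (measurableTypeR R) R lebesgue_measure _ `]0, h]%classic).
- exact: measurable_itv.
- exact: measurable_itv.
- exact: subset_itv_oc_cc.
- by rewrite [ltRHS]lebesgue_measure_itv/= lte_fin h0 sube0 lte_fin.
- exact: integrable_powR.
- by move=> r _; rewrite powR_ge0.
- by move=> r; rewrite /= in_itv/= => /andP[r0 _]; rewrite powR_gt0.
Qed.

(** The inner integral is a positive multiple of [K (x - t n.-1)], where [K h]
    is the integral of [r `^ (- alpha)] over [0, h]. As [K] is nondecreasing,
    it is measurable and bounded on the time step, so the outer integral is
    finite; it is positive because [K] is positive off 0. *)
Lemma L1p_coef_diag_gt0 alpha (t : nat -> R) n : 0 < alpha < 1 ->
  t n.-1 < t n -> 0 < L1p_coef alpha t n n.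
Proof.
move=> /andP[a0 a1] tn; rewrite /L1p_coef.
have taun : 0 < tau t n by rewrite subr_gt0.
have p1 : -1 < - alpha by lra.
have cG : 0 < (Gamma (1 - alpha))^-1 by rewrite invr_gt0 Gamma_gt0//; lra.
set c := (Gamma _)^-1 in cG.
pose K h := \int[mu]_(r in `[0, h]) (r `^ (- alpha)).
(* For [x] in the n-th time step, the upper bound [Num.min x (t n)] is [x]. *)
have inner x : x <= t n ->
    \int[mu]_(s in `[t n.-1, Num.min x (t n)]) omega (1 - alpha) (x - s) =
    K (x - t n.-1) * c.
  move=> xt; rewrite (min_idPl xt) /omega -/c [1 - alpha - 1]addrAC subrr add0r.
  rewrite -RintegralZr//; last exact: integrable_powR.
  rewrite /Rintegral; congr fine.
  rewrite (@ge0_integral_reflect _ _ (fun r => (r `^ (- alpha) * c)%:E))//.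
    by apply/measurable_EFinP; apply: measurable_funM => //; exact: measurable_powR.
  by move=> r; rewrite lee_fin mulr_ge0 ?powR_ge0// ltW.
rewrite mulr_gt0 ?invr_gt0 ?mulr_gt0//.
rewrite [ltRHS](_ : _ = \int[mu]_(x in `[t n.-1, t n]) (K (x - t n.-1) * c));
  last first.
  apply: eq_Rintegral => x /set_mem; rewrite /= in_itv/= => /andP[_ xt].
  exact: inner.
have K0 h : 0 <= K h by apply: Rintegral_ge0 => r _; exact: powR_ge0.
have Knd : nondecreasing_fun K by exact: nondecreasing_powR_integral.
apply: (@Rintegral_gt0 _ (measurableTypeR R) R lebesgue_measure _ `]t n.-1, t n]%classic).
- exact: measurable_itv.
- exact: measurable_itv.
- exact: subset_itv_oc_cc.
- by rewrite [ltRHS]lebesgue_measure_itv/= lte_fin tn -EFinB lte_fin.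
- apply: measurable_bounded_integrable.
  + exact: measurable_itv.
  + by rewrite [ltLHS]lebesgue_measure_itv/= lte_fin tn -EFinB ltry.
  + apply: measurable_funM => //; apply: nondecreasing_measurable => //.
    by move=> x y xy; apply: Knd; rewrite lerB.
  + exists (K (tau t n) * c); split; first exact: num_real.
    move=> M KM x /=; rewrite in_itv/= => /andP[_ xt].
    rewrite ger0_norm ?mulr_ge0// ?(ltW cG)//.
    by rewrite (le_trans _ (ltW KM))// ler_pM2r// Knd// lerB.
- by move=> x _; rewrite mulr_ge0// ltW.
- move=> x; rewrite /= in_itv/= => /andP[tx _].
  by rewrite mulr_gt0// powR_integral_gt0// subr_gt0.
Qed.

End kernel.

(** * Integration of continuous functions over a box *)

Section space.
Context {R : realType} {d : nat}.
Notation tupleT := (d.-tuple (measurableTypeR R)).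
Implicit Types (a b : 'rV[R]_d) (f g : 'rV[R]_d -> R).

Lemma measurable_forall_tnth (A : 'I_d -> set (measurableTypeR R)) :
  (forall i, measurable (A i)) ->
  measurable [set s : tupleT | forall i, A i (tnth s i)].
Proof.
move=> mA; rewrite (_ : [set s | _] =
    \bigcap_(i in [set: 'I_d]) ((fun s : tupleT => tnth s i) @^-1` A i)).
  apply: fin_bigcap_measurable => // i _; rewrite -[_ @^-1` _]setTI.
  exact: measurable_tnth.
by apply/seteqP; split => s /= As i => [_|]; exact: As.
Qed.

(** The sigma-algebra on tuples is generated by the coordinates, so it contains
    the balls of the sup norm; since the space is separable, these balls
    generate all open sets by countable unions. *)
Lemma measurable_row_preimage (U : set 'rV[R]_d) : open U ->
  measurable (row_of_tuple @^-1` U : set tupleT).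
Proof.
move=> oU.
pose q2r (q : 'rV[rat]_d) : 'rV[R]_d := map_mx ratr q.
pose B (p : 'rV[rat]_d * nat) := ball (q2r p.1) (p.2.+1%:R^-1 : R).
(* Balls not contained in [U] are replaced by the empty set, so that the union
   can run over a whole countable type. *)
pose F p : set 'rV[R]_d := [set x | B p `<=` U /\ B p x].
have -> : row_of_tuple @^-1` U = \bigcup_p (row_of_tuple @^-1` F p : set tupleT).
  apply/seteqP; split => [s Us|s [p _ [BU Bs]]]; last exact: BU.
  set x := row_of_tuple s.
  have [e /= e0 xeU] : exists2 e : R, 0 < e & ball x e `<=` U.
    by have /nbhs_ballP := open_nbhs_nbhs (conj oU Us).
  (* Twice the radius 1 / (n + 1) must be at most [e], for the rational centre
     is itself at distance up to 1 / (n + 1) from [x]. *)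
  pose n := Num.trunc (2 / e).
  have r0 : 0 < n.+1%:R^-1 :> R by rewrite invr_gt0.
  have re : n.+1%:R^-1 + n.+1%:R^-1 <= e.
    rewrite -mulr2n -[_ *+ 2]mulr_natl ler_pdivrMr// mulrC -ler_pdivrMr//.
    exact/ltW/truncnS_gt.
  have near_rat i : exists q : rat, `|x 0 i - ratr q| < n.+1%:R^-1.
    have [|q qx] := @rat_in_itvoo R (x 0 i - n.+1%:R^-1) (x 0 i + n.+1%:R^-1).
      by rewrite ltrBlDr -addrA ltrDl addr_gt0.
    by exists q; move: qx; rewrite in_itv/= ltr_distlC.
  pose q : 'rV[rat]_d := \row_i xchoose (near_rat i).
  have xq : ball x n.+1%:R^-1 (q2r q).
    split => // i j; have := xchooseP (near_rat j).
    by rewrite ord1 [q2r _ _ _]mxE [q _ _]mxE -ball_normE.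
  exists (q, n) => //; split; last exact: ball_sym.
  move=> y qy; apply: xeU; apply: le_ball re _ _.
  exact: ball_triangle xq qy.
apply: countable_bigcupT_measurable; first exact: countableP.
move=> p; have [BU|nBU] := pselect (B p `<=` U); last first.
  rewrite (_ : _ @^-1` _ = set0)//; by apply/seteqP; split => // s [].
rewrite (_ : _ @^-1` _ = [set s : tupleT | forall i,
    (ball (q2r p.1 0 i) (p.2.+1%:R^-1 : R)) (tnth s i : R)]).
  apply: (@measurable_forall_tnth
    (fun i => ball (q2r p.1 0 i) (p.2.+1%:R^-1 : R))) => i.
  exact: measurable_ball.
apply/seteqP; split => s /=.
  by move=> [_ [_ sp]] i; have := sp 0 i; rewrite [row_of_tuple _ _ _]mxE.
move=> sp; split => //; split => [|i j]; first by rewrite invr_gt0.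
by rewrite ord1 [row_of_tuple _ _ _]mxE; exact: sp.
Qed.

Lemma measurable_continuous_row (D : set tupleT) f : continuous f ->
  measurable_fun D (f \o row_of_tuple).
Proof.
move=> /continuousP cf; apply: measurable_funTS.
apply: (measurability _ (RGenOpens.measurableE R)).
move=> _ [_ [x [y ->] <-]]; rewrite setTI comp_preimage.
apply: measurable_row_preimage; apply: cf. exact: interval_open.
Qed.

Lemma row_preimage_box a b : row_of_tuple @^-1` box a b =
  [set s : tupleT | forall i, [set` `]a 0 i, b 0 i[] (tnth s i)].
Proof.
by apply/seteqP; split => s /= sab i; have := sab i; rewrite !mxE in_itv.
Qed.

Lemma measurable_row_box a b :
  measurable (row_of_tuple @^-1` box a b : set tupleT).
Proof.
rewrite row_preimage_box.
apply: (@measurable_forall_tnth (fun i => `]a 0 i, b 0 i[%classic)) => i.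
exact: measurable_itv.
Qed.

Lemma lebesgue_tuple_box_lty a b :
  (lebesgue_tuple (row_of_tuple @^-1` box a b) < +oo)%E.
Proof.
pose A i : set (measurableTypeR R) := `]a 0 i, b 0 i[%classic.
rewrite row_preimage_box -[X in lebesgue_tuple X]/[set s | forall i, A i (tnth s i)].
rewrite /lebesgue_tuple tuple_measure_box.
  rewrite ltey_eq prode_fin_num// => i _.
  by rewrite [X in X \is a _]lebesgue_measure_itv/=; case: ifP.
by move=> i; exact: measurable_itv.
Qed.

(** The open box lies in a compact one, whose image under [f] is compact. *)
Lemma bounded_on_box a b f : continuous f ->
  exists M, forall x, box a b x -> `|f x| <= M.
Proof.
move=> cf.
pose K : set 'rV[R]_d := [set x | forall i, `[a 0 i, b 0 i]%classic (x ord0 i)].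
have cK : compact K.
  by apply: (@rV_compact _ _ (fun i => `[a 0 i, b 0 i]%classic)) => i; exact: segment_compact.
have /compact_bounded[M [_ fM]] : compact (f @` K).
  by apply: continuous_compact => //; exact: continuous_subspaceT.
exists (M + 1) => x xab; apply: (fM (M + 1)); first by rewrite ltrDl.
exists x => // i; rewrite /= in_itv/=.
by have /andP[ax xb] := xab i; rewrite !ltW.
Qed.

Lemma integrable_continuous_box a b f : continuous f ->
  lebesgue_tuple.-integrable (row_of_tuple @^-1` box a b)
    (EFin \o (f \o row_of_tuple)).
Proof.
move=> cf; apply: measurable_bounded_integrable.
- exact: measurable_row_box.
- exact: lebesgue_tuple_box_lty.
- exact: measurable_continuous_row.
- have [M fM] := bounded_on_box a b _ cf.
  exists M; split; first exact: num_real.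
  by move=> N MN s /= sab; rewrite (le_trans (fM _ sab))// ltW.
Qed.

Lemma continuous_mul f g : continuous f -> continuous g ->
  continuous (fun x => f x * g x).
Proof. by move=> cf cg x; exact: (continuousM (cf x) (cg x)). Qed.

Lemma continuous_scale (c : R) f : continuous f -> continuous (fun x => c * f x).
Proof.
move=> cf; apply: (continuous_mul (fun=> c)) => //; exact: cst_continuous.
Qed.

Lemma continuous_add f g : continuous f -> continuous g ->
  continuous (fun x => f x + g x).
Proof. by move=> cf cg x; exact: (continuousD (cf x) (cg x)). Qed.

Lemma continuous_lincomb (I : eqType) (s : seq I) (c : I -> R)
    (F : I -> 'rV[R]_d -> R) : (forall i, i \in s -> continuous (F i)) ->
  continuous (fun x => \sum_(i <- s) c i * F i x).
Proof.
elim: s => [_|i s IHs cF].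
  rewrite (_ : (fun _ => _) = cst 0); first exact: cst_continuous.
  by apply/funext => x; rewrite big_nil.
under eq_fun do rewrite big_cons.
apply: (continuous_add (fun x => c i * F i x)).
  by apply: continuous_scale; apply: cF; rewrite mem_head.
by apply: IHs => j js; apply: cF; rewrite in_cons js orbT.
Qed.

Lemma space_integral_lincomb a b (I : eqType) (s : seq I) (c : I -> R)
    (F : I -> 'rV[R]_d -> R) : (forall i, i \in s -> continuous (F i)) ->
  space_integral (box a b) (fun x => \sum_(i <- s) c i * F i x) =
  \sum_(i <- s) c i * space_integral (box a b) (F i).
Proof.
rewrite /space_integral; elim: s => [_|i s IHs cF].
  rewrite big_nil; under eq_Rintegral do rewrite big_nil.
  by rewrite /Rintegral integral0.
have cFi : continuous (F i) by apply: cF; rewrite mem_head.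
have cFs j : j \in s -> continuous (F j).
  by move=> js; apply: cF; rewrite in_cons js orbT.
rewrite big_cons; under eq_Rintegral do rewrite big_cons.
have mbox := measurable_row_box a b.
rewrite (RintegralD mbox).
- rewrite RintegralZl ?IHs//; exact: integrable_continuous_box.
- apply: (integrable_continuous_box _ _ (fun x => c i * F i x)).
  exact: continuous_scale.
- apply: (integrable_continuous_box _ _ (fun x => \sum_(j <- s) c j * F j x)).
  exact: continuous_lincomb.
Qed.

Lemma space_integral_cst a b (c : R) :
  space_integral (box a b) (fun=> c) = c * vol (box a b).
Proof. by apply: Rintegral_cst; exact: measurable_row_box. Qed.

(** The cancellation behind volume conservation, to be applied with [f] the
    potential and [e] the multiplier [eta n]. *)
Lemma space_integral_sub_mean a b f (c e : R) :
  (forall i, a 0 i < b 0 i) -> continuous f ->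
  e = (vol (box a b))^-1 * space_integral (box a b) f ->
  space_integral (box a b) (fun x => c * (f x - e)) = 0.
Proof.
move=> ab cf eE; have mbox := measurable_row_box a b.
have vol0 : vol (box a b) != 0.
  by rewrite gt_eqF// vol_box// prodr_gt0// => i _; rewrite subr_gt0.
have int_e : space_integral (box a b) (fun=> e) = space_integral (box a b) f.
  by rewrite space_integral_cst eE mulrAC mulVf// mul1r.
have if_ := integrable_continuous_box a b f cf.
have ie : lebesgue_tuple.-integrable (row_of_tuple @^-1` box a b)
    (EFin \o ((fun=> e : R) \o @row_of_tuple R d)).
  by apply: integrable_continuous_box ; exact: cst_continuous.
rewrite /space_integral RintegralZl//; last first.
  apply: (integrable_continuous_box _ _ (fun x => f x - e)).
  by apply: continuous_add => //; exact: cst_continuous.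
rewrite RintegralB// -/(space_integral (box a b) f).
by rewrite -/(space_integral (box a b) (fun=> e)) int_e subrr mulr0.
Qed.

Lemma derive_midpoint (v : nat -> 'rV[R]_d -> R) n (w : 'rV[R]_d) :
  (forall x, derivable (v n) x w) -> (forall x, derivable (v n.-1) x w) ->
  'D_w (fun y => midpoint (v ^~ y) n) =
  (fun x => midpoint (fun k => 'D_w (v k) x) n).
Proof.
move=> df dg; apply/funext => x.
rewrite (_ : (fun y => _) = 2^-1 \*: (v n + v n.-1)).
  rewrite deriveZ; last exact: derivableD.
  by rewrite deriveD// /midpoint mulrC.
by apply/funext => y; rewrite /midpoint mulrC.
Qed.

Lemma continuous_midpoint (v : nat -> 'rV[R]_d -> R) n :
  continuous (v n) -> continuous (v n.-1) ->
  continuous (fun x => midpoint (v ^~ x) n).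
Proof.
move=> cf cg; apply: (continuous_mul (fun x => v n x + v n.-1 x)).
  exact: continuous_add.
exact: cst_continuous.
Qed.

Lemma continuous_laplacian_midpoint (v : nat -> 'rV[R]_d -> R) n :
  C2 (v n) -> C2 (v n.-1) ->
  continuous (laplacian (fun y => midpoint (v ^~ y) n)).
Proof.
move=> [_ v1 v2] [_ w1 w2].
have -> : laplacian (fun y => midpoint (v ^~ y) n) =
    (fun x => \sum_(i <- index_enum 'I_d) 1 *
       midpoint (fun k => 'D_(basis_vec i) ('D_(basis_vec i) (v k)) x) n).
  apply/funext => x; apply: eq_bigr => i _; rewrite mul1r.
  rewrite derive_midpoint; [|exact: (v1 i).1|exact: (w1 i).1].
  exact: (congr1 (@^~ x) (derive_midpoint (fun k => 'D_(basis_vec i) (v k)) n _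
    (v2 i i).1 (w2 i i).1)).
apply: continuous_lincomb => i _.
apply: (continuous_midpoint (fun k => 'D_(basis_vec i) ('D_(basis_vec i) (v k)))).
  exact: (v2 i i).2.
exact: (w2 i i).2.
Qed.

End space.

(** * The space-integrated scheme *)

Section scheme.
Context {R : realType} {d : nat}.
Implicit Types (a b : 'rV[R]_d) (f g : 'rV[R]_d -> R).

Lemma continuous_nabla (v : nat -> 'rV[R]_d -> R) n :
  continuous (v n) -> continuous (v n.-1) ->
  continuous (fun x => nabla (v ^~ x) n).
Proof.
by move=> cf cg x; exact: (continuousB (cf x) (cg x)).
Qed.

Lemma space_integral_nabla a b (v : nat -> 'rV[R]_d -> R) n :
  continuous (v n) -> continuous (v n.-1) ->
  space_integral (box a b) (fun x => nabla (v ^~ x) n) =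
  space_integral (box a b) (v n) - space_integral (box a b) (v n.-1).
Proof.
move=> cf cg; apply: RintegralB; first exact: measurable_row_box.
- exact: integrable_continuous_box.
- exact: integrable_continuous_box.
Qed.

Lemma continuous_extrap t phih (phi : nat -> 'rV[R]_d -> R) n :
  continuous phih -> (forall k, (k <= n)%N -> continuous (phi k)) ->
  continuous (extrap t phih phi n).
Proof.
rewrite /extrap => ch cphi; case: (n <= 1)%N => //.
have cpred k : (k <= n.-1)%N -> continuous (phi k).
  by move=> kn; apply: cphi; exact: leq_trans kn (leq_pred n).
apply: continuous_add; first exact: cpred.
apply: (continuous_mul (fun x => nabla (phi ^~ x) n.-1)).
  by apply: continuous_nabla; apply: cpred; rewrite ?leq_pred.
exact: cst_continuous.
Qed.

Lemma continuous_potential (eps beta : R) t phih (phi u : nat -> 'rV[R]_d -> R) n :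
  continuous phih -> (forall k, (k <= n)%N -> C2 (phi k)) ->
  (forall k, (k <= n)%N -> continuous (u k)) ->
  continuous (potential eps beta t phih phi u n).
Proof.
move=> ch hphi hu.
have cphi k : (k <= n)%N -> continuous (phi k) by move=> /hphi[].
have n1n : (n.-1 <= n)%N by exact: leq_pred.
apply: (continuous_add (fun x => - eps ^+ 2 *
    laplacian (fun y => midpoint (phi ^~ y) n) x + beta * midpoint (phi ^~ x) n)
  (fun x => midpoint (u ^~ x) n * extrap t phih phi n x)).
  apply: (continuous_add (fun x => - eps ^+ 2 * laplacian _ x)).
    by apply: continuous_scale; apply: continuous_laplacian_midpoint; apply: hphi.
  by apply: continuous_scale; apply: continuous_midpoint; apply: cphi.
apply: (continuous_mul (fun x => midpoint (u ^~ x) n)).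
  by apply: continuous_midpoint; apply: hu.
exact: continuous_extrap.
Qed.

Lemma space_integral_L1p a b alpha t (v : nat -> 'rV[R]_d -> R) n :
  (forall k, (k <= n)%N -> continuous (v k)) ->
  space_integral (box a b) (fun x => L1p alpha t (v ^~ x) n) =
  L1p alpha t (fun k => space_integral (box a b) (v k)) n.
Proof.
move=> cv; rewrite /L1p space_integral_lincomb.
  apply: eq_big_nat => k /andP[_ kn].
  rewrite space_integral_nabla//; apply: cv => //.
  exact: leq_trans (leq_pred k) kn.
move=> k; rewrite mem_index_iota => /andP[_ kn].
apply: continuous_nabla; apply: cv => //.
exact: leq_trans (leq_pred k) kn.
Qed.

End scheme.

(** The L1+ operator is triangular with positive diagonal in the increments of
    [v], hence injective on them. *)
Lemma L1p_eq0_stationary (R : realType) (alpha : R) (t v : nat -> R) N :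
  0 < alpha < 1 -> (forall k, (k < N)%N -> t k < t k.+1) ->
  (forall n, (1 <= n <= N)%N -> L1p alpha t v n = 0) ->
  forall n, (1 <= n <= N)%N -> v n = v n.-1.
Proof.
move=> ha ht hL; elim/ltn_ind => -[//|n] IH /andP[_ nN].
have := hL n.+1; rewrite nN => /(_ isT).
rewrite /L1p big_nat_recr//= big1_seq ?add0r; last first.
  move=> k /=; rewrite mem_index_iota => /andP[k0 kn].
  have kN : (k <= N)%N by rewrite (leq_trans _ nN)// ltnW.
  by rewrite /nabla (IH k)// ?k0// subrr mulr0.
move=> /eqP; rewrite mulf_eq0 gt_eqF/=; last first.
  by apply: L1p_coef_diag_gt0 => //; exact: ht.
by rewrite subr_eq0 => /eqP.
Qed.

Theorem theorem3p1 (R : realType) (d : nat) (a b : 'rV[R]_d)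
  (alpha lambda eps beta : R) (N : nat) (T : R) (t : nat -> R)
  (phi0 phih : 'rV[R]_d -> R) (phi u : nat -> 'rV[R]_d -> R)
  (eta : nat -> R)
  (hd : (0 < d)%N) (hab : forall i, a 0 i < b 0 i)
  (halpha : 0 < alpha < 1) (hlambda : 0 < lambda) (heps : 0 < eps)
  (ht : time_mesh N T t)
  (hphi : forall n, (n <= N)%N -> C2 (phi n) /\ box_periodic a b (phi n))
  (hu : forall n, (n <= N)%N -> continuous (u n) /\ box_periodic a b (u n))
  (hphih : continuous phih /\ box_periodic a b phih)
  (hphi0 : phi 0%N = phi0)
  (hu0 : forall x, u 0%N x = phi0 x ^+ 2 - 1 - beta)
  (hscheme : CN_IEQ alpha lambda eps beta (box a b) N t phih phi u eta) :
  forall n, (1 <= n <= N)%N ->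
    space_integral (box a b) (phi n) = space_integral (box a b) (phi n.-1).
Proof.
have [_ _ tlt _] := ht.
apply: (L1p_eq0_stationary _ alpha t (fun k => space_integral (box a b) (phi k)))
  => // n n1N.
have C2phi k : (k <= n)%N -> C2 (phi k).
  by move=> kn; apply: (hphi _ _).1; case/andP: n1N => _; exact: leq_trans.
have cu k : (k <= n)%N -> continuous (u k).
  by move=> kn; apply: (hu _ _).1; case/andP: n1N => _; exact: leq_trans.
have [eqphi eqeta _] := hscheme n n1N.
rewrite -space_integral_L1p; last by move=> k /C2phi[].
rewrite -[RHS](space_integral_sub_mean a b _ (- lambda) (eta n) hab _ eqeta).
  by apply: eq_Rintegral => s /set_mem sD; exact: eqphi.
by apply: continuous_potential => //; exact: hphih.1.
Qed.
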